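(* Let $\Phi=(\varphi_n)_{n\in\mathbb N}$ be a frame for a separable Hilbert space $\mathcal H$ and let $\mathcal A$ be an invertible operator in $B(\mathcal H)$. Then a sequence $\Phi^{gd}=(\varphi_n^{gd})_{n\in\mathbb N}$ in $\mathcal H$ is a g-dual frame of $\Phi$ with corresponding invertible operator $\mathcal A$ if and only if there exists $\Theta\in\mathrm{ran}_{B(\mathcal H,\ell^2)}(T_\Phi)$ such that $\varphi_n^{gd}=(\mathcal A^{-1})^*\widetilde\varphi_n+\Theta^*(\delta_n)$ for all $n\in\mathbb N$.
   Context: $\mathcal H$ is a separable Hilbert space, $B(\mathcal H)$ (resp. $B(\mathcal H,\ell^2)$) the bounded linear operators from $\mathcal H$ to $\mathcal H$ (resp. $\ell^2$), and $(\delta_n)_n$ the canonical orthonormal basis of $\ell^2$. A sequence $\Phi=(\varphi_n)_{n\in\mathbb N}$ in $\mathcal H$ is a frame if there are constants $m_\Phi,M_\Phi>0$ with $m_\Phi\|f\|^2\le\sum_{n}|\langle f,\varphi_n\rangle|^2\le M_\Phi\|f\|^2$ for all $f\in\mathcal H$. For a frame $\Phi$: the analysis operator is $U_\Phi:\mathcal H\to\ell^2$, $U_\Phi f=(\langle f,\varphi_n\rangle)_n$; the synthesis operator is $T_\Phi:\ell^2\to\mathcal H$, $T_\Phi((c_n)_n)=\sum_n c_n\varphi_n$; the frame operator $S_\Phi=T_\Phi U_\Phi$ is invertible, and $\widetilde\varphi_n:=S_\Phi^{-1}\varphi_n$. A frame $\Phi^{gd}=(\varphi_n^{gd})_n$ is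 a g-dual (generalized dual) frame of the frame $\Phi$ with corresponding invertible operator $\mathcal A\in B(\mathcal H)$ if $f=\sum_n\langle\mathcal A f,\varphi_n^{gd}\rangle\varphi_n$ for all $f\in\mathcal H$, i.e. $T_\Phi U_{\Phi^{gd}}=\mathcal A^{-1}$. Set $\mathrm{ran}_{B(\mathcal H,\ell^2)}(T_\Phi):=\{\Theta\in B(\mathcal H,\ell^2): T_\Phi\Theta=0\}$. *)

(* Defs.v *)
From HB Require Import structures.
From mathcomp Require Import all_boot all_order all_algebra.
From mathcomp.real_closed Require Import complex.
From mathcomp Require Import ring.
From mathcomp Require Import boolp classical_sets functions cardinality filter.
From mathcomp Require Import reals topology normedtype sequences.

Set Implicit Arguments.
Unset Strict Implicit.
Unset Printing Implicit Defensive.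

Import Order.TTheory GRing.Theory Num.Theory.
Import numFieldNormedType.Exports.

Local Open Scope classical_set_scope.
Local Open Scope ring_scope.
Local Open Scope complex_scope.

(* Hilbert spaces are taken over the real or over the complex numbers. *)
Variant scalarField := RealScalars of realType | ComplexScalars of realType.

Definition scalar_numField (K : scalarField) : numFieldType :=
  match K with RealScalars R => R | ComplexScalars R => R[i] end.
Coercion scalar_numField : scalarField >-> numFieldType.

Section scalars.
Variable K : scalarField.

Definition real_scalars : realType :=
  match K with RealScalars R | ComplexScalars R => R end.

Definition scalar_of_real : real_scalars -> K :=
  match K return
    match K with RealScalars R | ComplexScalars R => R end -> scalar_numField K
  with
  | RealScalars R => fun x => x
  | ComplexScalars R => fun x => x%:C
  end.

Definition scalar_conj : K -> K :=
  match K return scalar_numField K -> scalar_numField K with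
  | RealScalars R => fun x => x
  | ComplexScalars R => fun z => z^*
  end.

Definition scalar_re : K -> real_scalars :=
  match K return
    scalar_numField K -> match K with RealScalars R | ComplexScalars R => R end
  with
  | RealScalars R => fun x => x
  | ComplexScalars R => fun z => complex.Re z
  end.

Definition scalar_im : K -> real_scalars :=
  match K return
    scalar_numField K -> match K with RealScalars R | ComplexScalars R => R end
  with
  | RealScalars R => fun=> 0
  | ComplexScalars R => fun z => complex.Im z
  end.

Definition scalar_i : K :=
  match K return scalar_numField K with
  | RealScalars R => 0
  | ComplexScalars R => 'i%C
  end.

End scalars.

Section scalar_theory.
Variable K : scalarField.
Implicit Types x y : K.

Let conj_zmod : zmod_morphism (@scalar_conj K).
Proof. by case: K => R x y //=; rewrite rmorphB. Qed.
Let conj_monoid : monoid_morphism (@scalar_conj K).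
Proof.
case: K => R; split => //=; first exact: conjc1.
by move=> x y; rewrite (rmorphM (@conjc R)).
Qed.
HB.instance Definition _ :=
  GRing.isZmodMorphism.Build K K (@scalar_conj K) conj_zmod.
HB.instance Definition _ :=
  GRing.isMonoidMorphism.Build K K (@scalar_conj K) conj_monoid.

Lemma scalar_conjK : involutive (@scalar_conj K).
Proof. by case: K => R x //=; rewrite conjcK. Qed.

Lemma mul_scalar_conj x : x * scalar_conj x = `|x| ^+ 2.
Proof.
case: K x => R x /=; first by rewrite real_normK ?num_real// expr2.
by rewrite sqr_normc.
Qed.

Let of_real_zmod : zmod_morphism (@scalar_of_real K).
Proof. by case: K => R x y //=; rewrite rmorphB. Qed.
Let of_real_monoid : monoid_morphism (@scalar_of_real K).
Proof. by case: K => R; split => //= x y; rewrite rmorphM. Qed.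
HB.instance Definition _ :=
  GRing.isZmodMorphism.Build (real_scalars K) K (@scalar_of_real K) of_real_zmod.
HB.instance Definition _ :=
  GRing.isMonoidMorphism.Build (real_scalars K) K (@scalar_of_real K)
    of_real_monoid.

Lemma ler_scalar_of_real : {mono @scalar_of_real K : x y / x <= y}.
Proof. by case: K => R x y //=; rewrite lecR. Qed.

Lemma normr_scalar_of_real (r : real_scalars K) :
  `|scalar_of_real r| = scalar_of_real `|r|.
Proof. by case: K r => R r //=; rewrite normc_def /= expr0n addr0 sqrtr_sqr. Qed.

Lemma scalar_of_reK x : 0 <= x -> scalar_of_real (scalar_re x) = x.
Proof.
case: K x => R x //= x0; apply: RRe_real; exact: ger0_real.
Qed.

Lemma scalarE x :
  x = scalar_of_real (scalar_re x) + scalar_i K * scalar_of_real (scalar_im x).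
Proof. by case: K x => R x /=; [rewrite mul0r addr0 | exact: complexE]. Qed.

Lemma normr_scalar_re x : `|scalar_of_real (scalar_re x)| <= `|x|.
Proof.
case: K x => R //= [a b].
rewrite !normc_def /= lecR expr0n addr0; apply: ler_wsqrtr.
by rewrite lerDl sqr_ge0.
Qed.

Lemma normr_scalar_im x : `|scalar_of_real (scalar_im x)| <= `|x|.
Proof.
case: K x => R /=; first by move=> x; rewrite normr0.
move=> [a b]; rewrite !normc_def /= lecR expr0n addr0; apply: ler_wsqrtr.
by rewrite lerDr sqr_ge0.
Qed.

Lemma normr_scalar_conj x : `|scalar_conj x| = `|x|.
Proof. by case: K x => R x //=; rewrite normcJ. Qed.

Lemma scalar_conj_of_real (r : real_scalars K) :
  scalar_conj (scalar_of_real r) = scalar_of_real r.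
Proof. by case: K r => R r //=; rewrite oppr0. Qed.

Lemma scalar_conj_ge0 x : 0 <= x -> scalar_conj x = x.
Proof. by move=> /scalar_of_reK <-; exact: scalar_conj_of_real. Qed.

End scalar_theory.

Section scalar_sequences.
Variable K : scalarField.
Implicit Types u v : nat -> K.

Lemma cvg_scalar_of_real (r : nat -> real_scalars K) l :
  r @ \oo --> l -> (@scalar_of_real K \o r) @ \oo --> scalar_of_real l.
Proof.
move=> /cvgrPdist_lt rl; apply/cvgrPdist_lt => e e0.
have e0' : 0 < scalar_re e.
  by rewrite -(leW_mono (@ler_scalar_of_real K)) rmorph0 scalar_of_reK// ltW.
near=> n; rewrite /= -rmorphB normr_scalar_of_real.
rewrite -[ltRHS]scalar_of_reK ?(ltW e0)// (leW_mono (@ler_scalar_of_real K)).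
by near: n; exact: rl.
Unshelve. all: by end_near. Qed.

Lemma cvg_scalar_conj u l :
  u @ \oo --> l -> (@scalar_conj K \o u) @ \oo --> scalar_conj l.
Proof.
move=> /cvgrPdist_lt ul; apply/cvgrPdist_lt => e e0.
by near=> n; rewrite /= -rmorphB normr_scalar_conj; near: n; exact: ul.
Unshelve. all: by end_near. Qed.

Lemma is_cvg_nneg_series u (M : K) : (forall n, 0 <= u n) ->
  (forall n, series u n <= M) -> cvgn (series u).
Proof.
move=> u0 uM; pose r n := scalar_re (u n).
have ur : series u = @scalar_of_real K \o series r.
  apply/funext => n; rewrite /series /= rmorph_sum.
  by apply: eq_bigr => i _; rewrite /= scalar_of_reK.
have r0 n : 0 <= r n by rewrite -ler_scalar_of_real rmorph0 scalar_of_reK.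
have M0 : 0 <= M by have := uM 0%N; rewrite /series /= big_geq.
rewrite ur; suff /cvg_ex[l /cvg_scalar_of_real rl] : cvgn (series r).
  by apply/cvg_ex; exists (scalar_of_real l).
apply: nondecreasing_is_cvgn.
  by apply/nondecreasing_seqP => n; rewrite /series /= big_nat_recr//= lerDl.
exists (scalar_re M) => _ [n _ <-].
by rewrite -ler_scalar_of_real scalar_of_reK// -[leLHS]/((_ \o _) n) -ur.
Qed.

Lemma limn_nneg u : cvgn u -> (forall n, 0 <= u n) -> 0 <= limn u.
Proof.
move=> cu u0; rewrite (_ : limn u = `|limn u|)//.
apply: cvg_lim => //; rewrite [X in X @ _ --> _](_ : u = fun n => `|u n|).
  exact: cvg_norm.
by apply/funext => n; rewrite ger0_norm.
Qed.

Lemma nneg_series_le u n : cvgn (series u) -> (forall n, 0 <= u n) ->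
  series u n <= limn (series u).
Proof.
move=> cu u0; have /cvg_lim : (fun m => series u (m + n)%N - series u n) @ \oo
    --> limn (series u) - series u n.
  by apply: cvgB; [rewrite (cvg_shiftn n (series u)) | exact: cvg_cst].
move=> /(_ (@norm_hausdorff _ _)) limE; rewrite -subr_ge0 -limE.
apply: limn_nneg.
  apply: is_cvgB; [|exact: is_cvg_cst].
  by apply/cvg_ex; exists (limn (series u)); rewrite (cvg_shiftn n (series u)).
by move=> m; rewrite sub_series_geq ?leq_addl// sumr_ge0.
Qed.

Lemma is_cvg_scalar_of_real (r : nat -> real_scalars K) :
  cvgn r -> cvgn (@scalar_of_real K \o r).
Proof.
by move=> /cvg_ex[l /cvg_scalar_of_real rl]; apply/cvg_ex; exists (scalar_of_real l).
Qed.

Lemma is_cvg_normed_series u : cvgn (series (fun n => `|u n|)) -> cvgn (series u).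
Proof.
move=> cu; pose M := scalar_re (limn (series (fun n => `|u n|))).
have real_part (p : K -> real_scalars K) :
    (forall x, `|scalar_of_real (p x)| <= `|x|) ->
    cvgn (series (@scalar_of_real K \o p \o u)).
  move=> pu; suff : cvgn (series (p \o u)).
    have -> : series (@scalar_of_real K \o p \o u) =
        @scalar_of_real K \o series (p \o u).
      by apply/funext => n; rewrite /series /= rmorph_sum.
    exact: is_cvg_scalar_of_real.
  apply: normed_cvg; apply: nondecreasing_is_cvgn.
    by apply: nondecreasing_series => n _ _; exact: normr_ge0.
  exists M => _ [n _ <-]; rewrite -ler_scalar_of_real scalar_of_reK; last first.
    by apply: limn_nneg => // m; rewrite /series /= sumr_ge0.
  apply: le_trans (nneg_series_le n cu _) => //.
  rewrite /series /= rmorph_sum; apply: ler_sum => i _.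
  by rewrite /= -normr_scalar_of_real pu.
rewrite (_ : series u = series (@scalar_of_real K \o @scalar_re K \o u) +
    scalar_i K *: series (@scalar_of_real K \o @scalar_im K \o u)).
  apply: is_cvgD; first by apply: real_part; exact: normr_scalar_re.
  by apply: is_cvgZl_tmp; apply: real_part; exact: normr_scalar_im.
apply/funext => n; rewrite /series /= !fctE /= scaler_sumr -big_split /=.
by apply: eq_bigr => i _; exact: scalarE.
Qed.

Lemma nneg_series_le_cvg u v : (forall n, 0 <= u n <= v n) ->
  cvgn (series v) -> cvgn (series u).
Proof.
move=> uv cv; have u0 n : 0 <= u n by have /andP[] := uv n.
have v0 n : 0 <= v n by have /andP[/le_trans] := uv n; apply.
apply: (@is_cvg_nneg_series _ (limn (series v))) => // n.
apply: le_trans (nneg_series_le n cv v0).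
by rewrite /series /= ler_sum// => i _; have /andP[] := uv i.
Qed.

End scalar_sequences.

(* [inner] is linear in its first argument. *)
HB.mixin Record NormedModule_isPreHilbert (K : scalarField) H
    & NormedModule K H := {
  inner : {dot H for @scalar_conj K} ;
  normr_inner : forall x : H, `|x| ^+ 2 = inner x x
}.

#[short(type="preHilbertType")]
HB.structure Definition PreHilbert (K : scalarField) :=
  {H of NormedModule K H & NormedModule_isPreHilbert K H}.

#[short(type="hilbertType")]
HB.structure Definition Hilbert (K : scalarField) :=
  {H of CompleteNormedModule K H & NormedModule_isPreHilbert K H}.

Section dot_norm.
Variables (K : scalarField) (V : lmodType K) (form : {dot V for @scalar_conj K}).

Definition scalar_sqrt (x : K) : K := scalar_of_real (Num.sqrt (scalar_re x)).

Lemma scalar_sqrt_ge0 x : 0 <= scalar_sqrt x.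
Proof. by rewrite -[0](rmorph0 (@scalar_of_real K)) ler_scalar_of_real sqrtr_ge0. Qed.

Lemma sqr_scalar_sqrt x : 0 <= x -> scalar_sqrt x ^+ 2 = x.
Proof.
move=> x0; rewrite -rmorphXn /= sqr_sqrtr ?scalar_of_reK//.
by rewrite -ler_scalar_of_real rmorph0 scalar_of_reK.
Qed.

Lemma dot_ge0 u : 0 <= form u u.
Proof.
have [->|u0] := eqVneq u 0; first by rewrite linear0l.
by rewrite ltW// neq0_dnorm_gt0.
Qed.

Lemma dot_conj u v : form v u = scalar_conj (form u v).
Proof. by rewrite (hermC form) expr0 mul1r. Qed.

Lemma dot_CauchySchwarz u v : `|form u v| ^+ 2 <= form u u * form v v.
Proof.
have [->|v0] := eqVneq v 0; first by rewrite !linear0r normr0 expr0n mulr0.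
have vv0 : 0 < form v v by exact: neq0_dnorm_gt0.
pose a := form u v / form v v.
have cE : scalar_conj a * form v v = form v u.
  rewrite rmorphM fmorphV /= (scalar_conj_ge0 (ltW vv0)) divfK ?gt_eqF//.
  by rewrite -dot_conj.
have := dot_ge0 (u - a *: v).
rewrite linearBl !linearBr !linearZl_LR !linearZr_LR /=.
rewrite -mulrBr cE subrr mulr0 subr0 subr_ge0.
rewrite rmorphM fmorphV /= (scalar_conj_ge0 (ltW vv0)) mulrAC.
by rewrite [_ * form u v]mulrC mul_scalar_conj ler_pdivrMr.
Qed.

Lemma dot_normD u v : scalar_sqrt (form (u + v) (u + v)) <=
  scalar_sqrt (form u u) + scalar_sqrt (form v v).
Proof.
rewrite -(@ler_pXn2r _ 2)// ?nnegrE ?addr_ge0 ?scalar_sqrt_ge0//.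
rewrite sqrrD !sqr_scalar_sqrt ?dot_ge0//.
have uvE : form (u + v) (u + v) =
    form u u + (form u v + form v u) + form v v.
  by rewrite linearDl !linearDr !addrA.
rewrite uvE lerD2r lerD2l.
have uvR : form u v + form v u \is Num.real.
  have -> : form u v + form v u = form (u + v) (u + v) - form u u - form v v.
    by rewrite uvE (addrAC _ (- form u u)) addrK [form u u + _]addrC addrK.
  by rewrite !rpredB// ger0_real// dot_ge0.
apply: le_trans (real_ler_norm uvR) _; apply: le_trans (ler_normD _ _) _.
rewrite (dot_conj u v) normr_scalar_conj -mulr2n lerMn2r /=.
rewrite -(@ler_pXn2r _ 2)// ?nnegrE ?mulr_ge0 ?scalar_sqrt_ge0//.
by rewrite exprMn !sqr_scalar_sqrt ?dot_ge0// dot_CauchySchwarz.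
Qed.

Lemma dot_normZ a u :
  scalar_sqrt (form (a *: u) (a *: u)) = `|a| * scalar_sqrt (form u u).
Proof.
apply/eqP; rewrite -(@eqrXn2 _ 2)// ?mulr_ge0 ?scalar_sqrt_ge0//.
rewrite exprMn !sqr_scalar_sqrt ?dot_ge0//.
by rewrite linearZl_LR linearZr_LR /= mulrA mul_scalar_conj.
Qed.

Lemma dot_norm_eq0 u : scalar_sqrt (form u u) = 0 -> u = 0.
Proof.
move=> u0; apply/eqP/negP => /negP uN0.
have : 0 < form u u by exact: neq0_dnorm_gt0.
by rewrite -(sqr_scalar_sqrt (dot_ge0 u)) u0 expr0n ltxx.
Qed.

End dot_norm.

Definition square_summable (K : scalarField) : {pred nat -> K} :=
  [pred c : nat -> K | `[< cvgn (series (fun n => `|c n| ^+ 2 : K)) >]].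

Lemma square_summableP (K : scalarField) (c : nat -> K) :
  reflect (cvgn (series (fun n => `|c n| ^+ 2 : K))) (c \in @square_summable K).
Proof. by rewrite unfold_in; exact: asboolP. Qed.

Lemma square_summable_submod (K : scalarField) :
  submod_closed (@square_summable K).
Proof.
split=> [|a c d].
  apply/square_summableP; apply: (@is_cvg_nneg_series _ _ 0) => n.
    exact: exprn_ge0.
  by rewrite /series /= big1// => i _; rewrite normr0 expr0n.
move=> /square_summableP cs /square_summableP ds; apply/square_summableP.
pose v : nat -> K :=
  (2 * `|a| ^+ 2) *: (fun n => `|c n| ^+ 2) + (2 : K) *: (fun n => `|d n| ^+ 2).
apply: (@nneg_series_le_cvg _ _ v) => [n|].
  rewrite exprn_ge0//= /v !fctE /GRing.scale /=.
  have xyR : `|a| * `|c n| - `|d n| \is Num.real by rewrite realB ?realM ?normr_real.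
  apply: (@le_trans _ _ ((`|a| * `|c n| + `|d n|) ^+ 2)).
    by rewrite lerXn2r ?nnegrE ?addr_ge0 ?mulr_ge0// -normrM ler_normD.
  rewrite -subr_ge0; have := real_exprn_even_ge0 xyR (isT : ~~ odd 2).
  by congr (0 <= _); ring.
rewrite /v seriesD; apply: is_cvgD; rewrite seriesZ; exact: is_cvgZl_tmp.
Qed.

HB.instance Definition _ (K : scalarField) :=
  GRing.isSubmodClosed.Build K (nat -> K) (@square_summable K)
    (@square_summable_submod K).

Record ell2 (K : scalarField) := Ell2 {
  ell2_seq :> nat -> K ;
  ell2P : ell2_seq \in @square_summable K
}.

HB.instance Definition _ (K : scalarField) := [isSub for @ell2_seq K].
HB.instance Definition _ (K : scalarField) := [Choice of ell2 K by <:].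
HB.instance Definition _ (K : scalarField) :=
  [SubChoice_isSubLmodule of ell2 K by <:].

Section ell2_inner.
Variable K : scalarField.
Implicit Types c d e : ell2 K.

Definition ell2_inner c d : K :=
  limn (series (fun n => c n * scalar_conj (d n))).

Lemma is_cvg_ell2_inner c d :
  cvgn (series (fun n => c n * scalar_conj (d n))).
Proof.
apply: is_cvg_normed_series.
apply: (@nneg_series_le_cvg _ _ ((fun n => `|c n| ^+ 2) + (fun n => `|d n| ^+ 2))).
  move=> n; rewrite normr_ge0 fctE normrM normr_scalar_conj /=.
  apply: le_trans (real_leif_mean_square (normr_real _) (normr_real _)) _.
  by rewrite ler_pdivrMr// ler_peMr ?addr_ge0 ?exprn_ge0// ler1n.
rewrite seriesD.
by apply: is_cvgD; apply/square_summableP; exact: ell2P.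
Qed.

Let ell2_innerDZl d : scalar (ell2_inner ^~ d).
Proof.
move=> a c e; rewrite /ell2_inner.
have -> : (fun n => (a *: c + e) n * scalar_conj (d n)) =
   a *: (fun n => c n * scalar_conj (d n)) + (fun n => e n * scalar_conj (d n)).
  by apply/funext => n; rewrite !fctE /= mulrDl -mulrA.
have cc := @is_cvg_ell2_inner c d; have ce := @is_cvg_ell2_inner e d.
by rewrite (lim_seriesD (is_cvg_seriesZ cc) ce) (lim_seriesZ _ cc).
Qed.

Let ell2_inner_conj c d : ell2_inner c d = scalar_conj (ell2_inner d c).
Proof.
apply: cvg_lim => //; rewrite (_ : series _ = @scalar_conj K \o
  series (fun n => d n * scalar_conj (c n))).
  exact/cvg_scalar_conj/is_cvg_ell2_inner.
apply/funext => n; rewrite /series /= rmorph_sum; apply: eq_bigr => i _ /=.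
by rewrite rmorphM /= scalar_conjK mulrC.
Qed.

Let ell2_inner_bilinear :
  bilinear_for *%R (@scalar_conj K \; *%R) ell2_inner.
Proof.
split=> [d|c] a; first exact: ell2_innerDZl.
move=> d e; rewrite !(ell2_inner_conj c) ell2_innerDZl.
by rewrite /= rmorphD rmorphM.
Qed.

HB.instance Definition _ := bilinear_isBilinear.Build K (ell2 K) (ell2 K) K
  *%R (@scalar_conj K \; *%R) ell2_inner ell2_inner_bilinear.

Let ell2_inner_herm c d :
  ell2_inner c d = (-1) ^+ false * scalar_conj (ell2_inner d c).
Proof. by rewrite expr0 mul1r. Qed.

HB.instance Definition _ := isHermitianSesquilinear.Build K (ell2 K) false
  (@scalar_conj K) ell2_inner ell2_inner_herm.

Let ell2_inner_gt0 c : c != 0 -> 0 < ell2_inner c c.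
Proof.
move=> c0; have [n cn0] : exists n, c n != 0.
  apply: contrapT => h; move/eqP: c0; apply; apply/val_inj/funext => n /=.
  by apply/eqP/negPn/negP => cn0; apply: h; exists n.
have sE : (fun n => c n * scalar_conj (c n)) = (fun n => `|c n| ^+ 2).
  by apply/funext => m; rewrite mul_scalar_conj.
rewrite /ell2_inner sE.
apply: lt_le_trans (@nneg_series_le _ _ n.+1 _ _).
- rewrite /series /= big_nat_recr//= ltr_wpDl ?sumr_ge0// ?exprn_gt0 ?normr_gt0//.
  by move=> i _; exact: exprn_ge0.
- by apply/square_summableP; exact: ell2P.
- by move=> m; exact: exprn_ge0.
Qed.

HB.instance Definition _ := isDotProduct.Build K (ell2 K) ell2_inner ell2_inner_gt0.

End ell2_inner.

HB.instance Definition _ (K : scalarField) :=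
  Lmodule_isNormed.Build K (ell2 K)
    (dot_normD (@ell2_inner K)) (dot_normZ (@ell2_inner K))
    (dot_norm_eq0 (form := @ell2_inner K)).

Lemma ell2_normr_inner (K : scalarField) (c : ell2 K) :
  `|c| ^+ 2 = ell2_inner c c.
Proof. by apply: sqr_scalar_sqrt; exact: (dot_ge0 (@ell2_inner K)). Qed.

HB.instance Definition _ (K : scalarField) :=
  NormedModule_isPreHilbert.Build K (ell2 K) (@ell2_normr_inner K).

Lemma ell2_basis_subproof (K : scalarField) (n : nat) :
  (fun i => (i == n)%:R : K) \in @square_summable K.
Proof.
apply/square_summableP; apply: (@is_cvg_nneg_series _ _ 1) => m.
  exact: exprn_ge0.
rewrite /series /= (eq_bigr (fun i => if i == n then 1 else 0)); last first.
  by move=> i _; case: eqP => _; rewrite ?normr1 ?expr1n// normr0 expr0n.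
rewrite -big_mkcond big_const_seq iter_addr_0 /= -[leRHS]/(1%:R) ler_nat.
by rewrite -/(count_mem n _) (count_uniq_mem _ (iota_uniq _ _)) leq_b1.
Qed.

Definition ell2_basis (K : scalarField) (n : nat) : ell2 K :=
  Ell2 (ell2_basis_subproof K n).

Definition separable (T : topologicalType) : Prop :=
  exists2 D : set T, countable D & dense D.

Definition bounded_op (K : scalarField) (V W : preHilbertType K) : set (V -> W) :=
  [set T | linear T /\ exists M : K, forall x, `|T x| <= M * `|x|].

Definition invertible_op (K : scalarField) (V : preHilbertType K) : set (V -> V) :=
  [set T | bounded_op T /\ exists S, [/\ bounded_op S, cancel T S & cancel S T]].

Definition op_inv (K : scalarField) (V : preHilbertType K) (T : V -> V) : V -> V :=
  pinv setT T.

(* [adjoint T y] is the z with <T x, y> = <x, z> for all x; it is unique, and *)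
(* exists when T is bounded linear and V is complete (0 is a default value).  *)
Definition adjoint (K : scalarField) (V W : preHilbertType K) (T : V -> W)
    (y : W) : V :=
  xget 0 [set z | forall x, inner (T x) y = inner x z].

(* ran_B(U, V)(T), the right annihilator of T *)
Definition op_ran (K : scalarField) (U V W : preHilbertType K) (T : V -> W) :
    set (U -> V) :=
  [set S | bounded_op S /\ forall x, T (S x) = 0].

Section frames.
Variables (K : scalarField) (H : hilbertType K).
Implicit Types Phi : nat -> H.

(* [0 < m] and [0 < M] force m and M to be real, also when K is complex. *)
Definition frame Phi : Prop :=
  exists m M : K, [/\ 0 < m, 0 < M & forall f : H,
    let energy : nat -> K := series (fun n => `|inner f (Phi n)| ^+ 2) in
    cvgn energy /\ m * `|f| ^+ 2 <= limn energy <= M * `|f| ^+ 2].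

(* The coefficients of f are square summable when Phi is a frame; 0 is the    *)
(* default value otherwise.                                                   *)
Definition analysis_op Phi (f : H) : ell2 K :=
  insubd 0 (fun n => inner f (Phi n)).

Definition synthesis_op Phi (c : ell2 K) : H :=
  limn (series (fun n => c n *: Phi n)).

Definition frame_op Phi : H -> H := synthesis_op Phi \o analysis_op Phi.

Definition canonical_dual Phi (n : nat) : H := op_inv (frame_op Phi) (Phi n).

Definition g_dual_frame Phi (A : H -> H) (Psi : nat -> H) : Prop :=
  frame Psi /\
  forall f : H, series (fun n => inner (A f) (Psi n) *: Phi n) @ \oo --> f.

End frames.

(* Main.v *)
(* Write T, U and S = T U for the synthesis, analysis and frame operators of
   Phi, and put W = U S^-1 A^-1, so that T W = A^-1 and the n-th coordinate of
   W f is the inner product of f with (A^-1)^* S^-1 phi_n.  Being g-dual for A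
   means T U_gd = A^-1, i.e. U_gd = W + Theta with T Theta = 0; conversely the
   lower frame bound for W + Theta follows from f = A T (W + Theta) f.  The frame
   operator is inverted by a Neumann series for 1 - t S, and the frame itself
   provides the Riesz representatives that define adjoints. *)
Require Import Defs.
From mathcomp Require Import all_boot all_order all_algebra.
From mathcomp Require Import ring.
From mathcomp Require Import boolp classical_sets functions cardinality filter.
From mathcomp Require Import reals topology normedtype sequences.

Import Order.TTheory GRing.Theory Num.Theory.
Import numFieldNormedType.Exports.

Local Open Scope classical_set_scope.
Local Open Scope ring_scope.

(** * Consequences of Cauchy-Schwarz and nondegeneracy *)

Section inner_theory.
Context {K : scalarField} {V : preHilbertType K}.
Implicit Types x y z : V.

Lemma inner_conj x y : inner y x = scalar_conj (inner x y).
Proof. exact: (dot_conj (@inner K V)). Qed.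

Lemma normr_inner_le x y : `|inner x y| <= `|x| * `|y|.
Proof.
rewrite -(@ler_pXn2r _ 2)// ?nnegrE ?mulr_ge0//.
by rewrite exprMn !normr_inner; exact: (dot_CauchySchwarz (@inner K V)).
Qed.

Lemma inner_inj y z : (forall x, inner x y = inner x z) -> y = z.
Proof.
move=> yz; apply/eqP; rewrite -subr_eq0 -normr_eq0 -sqrf_eq0 normr_inner.
by rewrite linearBr /= yz subrr.
Qed.

Lemma inner_injl x z : (forall y, inner x y = inner z y) -> x = z.
Proof. by move=> xz; apply: inner_inj => y; rewrite inner_conj xz -inner_conj. Qed.

Lemma cvg_inner (u : nat -> V) x y :
  u @ \oo --> x -> (fun n => inner (u n) y) @ \oo --> inner x y.
Proof.
move=> /cvgrPdist_lt ux; apply/cvgrPdist_lt => e e0.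
(* Adding 1 keeps the factor positive, so that [e] can be divided by it even when [y] is 0. *)
have y0 : 0 < `|y| + 1 by rewrite ltr_wpDl.
near=> n; rewrite -linearBl (le_lt_trans (normr_inner_le _ _))//.
apply: (@le_lt_trans _ _ (`|x - u n| * (`|y| + 1))).
  by rewrite ler_wpM2l// lerDl.
by rewrite -ltr_pdivlMr//; near: n; apply: ux; exact: divr_gt0.
Unshelve. all: by end_near. Qed.

End inner_theory.

(** [adjoint] chooses its value among representing vectors; nondegeneracy leaves only one candidate,
    so exhibiting it computes the adjoint. *)
Lemma adjoint_unique {K : scalarField} {V W : preHilbertType K}
    (T : V -> W) y z :
  (forall x, inner (T x) y = inner x z) -> adjoint T y = z.
Proof.
move=> Tz; apply: xget_unique => // z' Tz'.
by apply: inner_inj => x; rewrite -Tz -Tz'.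
Qed.

(** * Bounded linear operators *)

Section bounded_operators.
Context {K : scalarField}.

Lemma linear_opB {V W : preHilbertType K} {T : V -> W} : linear T ->
  {morph T : x y / x - y}.
Proof. by move=> lT x y; rewrite addrC -scaleN1r lT scaleN1r addrC. Qed.

Lemma linear_op0 {V W : preHilbertType K} {T : V -> W} : linear T -> T 0 = 0.
Proof. by move=> lT; rewrite -(subrr 0) (linear_opB lT) subrr. Qed.

Lemma linear_opZ {V W : preHilbertType K} {T : V -> W} : linear T ->
  forall a, {morph T : x / a *: x}.
Proof. by move=> lT a x; rewrite -[a *: x]addr0 lT (linear_op0 lT) addr0. Qed.

Lemma linear_op_sum {V W : preHilbertType K} {T : V -> W} : linear T ->
  forall n (u : nat -> V), T (series u n) = series (T \o u) n.
Proof.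
move=> lT n u; rewrite /series /=.
elim: n => [|n IHn]; first by rewrite !big_geq// (linear_op0 lT).
by rewrite !big_nat_recr//= -IHn -[_ + u n]addrC -[u n]scale1r lT !scale1r addrC.
Qed.

Lemma bounded_op_gt0 {V W : preHilbertType K} {T : V -> W} : bounded_op T ->
  exists2 M, 0 < M & forall x, `|T x| <= M * `|x|.
Proof.
move=> [_ [M TM]]; exists (`|M| + 1); first by rewrite ltr_wpDl.
move=> x; apply: le_trans (TM x) _.
(* On the zero space [M] may be negative or non-real; yet [M * |x|] dominates a norm, so it equals
   [|M| * |x|]. *)
have /ger0_norm <- : 0 <= M * `|x| by exact: le_trans (TM x).
by rewrite normrM normr_id ler_wpM2r// lerDl.
Qed.

Lemma bounded_op_comp {U V W : preHilbertType K} {S : V -> W} {T : U -> V} :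
  bounded_op S -> bounded_op T -> bounded_op (S \o T).
Proof.
move=> bS bT; have [M M0 SM] := bounded_op_gt0 bS.
have [N N0 TN] := bounded_op_gt0 bT.
split=> [a x y|]; first by rewrite /= bT.1 bS.1.
exists (M * N) => x; apply: le_trans (SM _) _.
by rewrite -mulrA ler_pM2l.
Qed.

Lemma bounded_opD {V W : preHilbertType K} {S T : V -> W} :
  bounded_op S -> bounded_op T -> bounded_op (S \+ T).
Proof.
move=> [lS [M SM]] [lT [N TN]]; split=> [a x y|].
  by rewrite /= lS lT scalerDr addrACA.
exists (M + N) => x; apply: le_trans (ler_normD _ _) _.
by rewrite mulrDl lerD.
Qed.

Lemma bounded_opB {V W : preHilbertType K} {S T : V -> W} :
  bounded_op S -> bounded_op T -> bounded_op (S \- T).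
Proof.
move=> bS [lT [N TN]]; apply: (bounded_opD bS); split=> [a x y|].
  by rewrite lT opprD scalerN.
by exists N => x; rewrite normrN.
Qed.

Lemma bounded_op_cvg {V W : preHilbertType K} {T : V -> W} {u : nat -> V} {x} :
  bounded_op T -> u @ \oo --> x -> (T \o u) @ \oo --> T x.
Proof.
move=> bT /cvgrPdist_lt ux; have [M M0 TM] := bounded_op_gt0 bT.
apply/cvgrPdist_lt => e e0; near=> n.
rewrite /= -(linear_opB bT.1) (le_lt_trans (TM _))//.
by rewrite -ltr_pdivlMl//; near: n; apply: ux; rewrite mulr_gt0 ?invr_gt0.
Unshelve. all: by end_near. Qed.

(** [op_inv] is a chosen preimage: [B] shows that one exists, and injectivity of [A] that it is
    unique. *)
Lemma op_invE {V : preHilbertType K} {A B : V -> V} :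
  cancel A B -> cancel B A -> op_inv A = B.
Proof.
move=> AB BA; apply/funext => x; rewrite -{1}[x]BA /op_inv.
by rewrite pinvKV ?inE// => y z _ _; exact: can_inj AB _ _.
Qed.

End bounded_operators.

(** * Coordinates and norm in the sequence space *)

Section ell2_theory.
Context {K : scalarField}.
Implicit Types c d : ell2 K.

Lemma cvg_ell2_inner c d :
  series (fun n => c n * scalar_conj (d n)) @ \oo --> inner c d.
Proof. exact: is_cvg_ell2_inner. Qed.

Lemma cvg_ell2_norm c : series (fun n => `|c n| ^+ 2) @ \oo --> `|c| ^+ 2.
Proof.
rewrite normr_inner; have := cvg_ell2_inner c c.
by under eq_fun do rewrite mul_scalar_conj.
Qed.

Lemma inner_ell2_basis c n : inner c (ell2_basis K n) = c n.
Proof.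
apply: (@cvg_unique _ (@norm_hausdorff _ _)) (cvg_ell2_inner _ _) _.
(* The partial sums are constant once they include index [n]. *)
apply: cvg_near_cst; near=> m.
have nm : (n < m)%N by near: m; exact: nbhs_infty_gt.
rewrite /series /= big_mkord (bigD1 (Ordinal nm))//= eqxx rmorph1 mulr1.
rewrite big1 ?addr0// => i ni; rewrite (_ : (i == n :> nat) = false).
  by rewrite rmorph0 mulr0.
by apply/negbTE/eqP => e; move/eqP: ni; apply; exact/val_inj.
Unshelve. all: by end_near. Qed.

End ell2_theory.

(* With [a = |x|^2], [s = <Sx, x>], [b = |Sx|^2], the left-hand side is
   [|x - tSx|^2] for [t = m / N^2]. *)
Lemma coercive_step_le {F : numFieldType} {m N t a s b : F} : 0 < m -> 0 < N ->
  m * a <= s -> b <= N ^+ 2 * a -> t = m / N ^+ 2 ->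
  a - t * s - (t * s - t * (t * b)) <= (1 - (m / N) ^+ 2) * a.
Proof.
move=> m0 N0 mas bNa tE; have t0 : 0 < t by rewrite tE divr_gt0 ?exprn_gt0.
have -> : (1 - (m / N) ^+ 2) * a =
    a - t * (m * a) - (t * (m * a) - t * (t * (N ^+ 2 * a))).
  by rewrite tE; field; rewrite gt_eqF.
by apply: lerD; rewrite ?lerN2; [rewrite lerD2l lerN2|apply: lerB];
  rewrite !ler_pM2l.
Qed.

(** * Inversion of coercive operators *)

Section positive_operators.
Context {K : scalarField} {H : hilbertType K}.

Lemma is_cvg_hilbert_normed_series (u : nat -> H) :
  cvgn (series (fun n => `|u n| : K)) -> cvgn (series u).
Proof.
move=> /cvg_cauchy/cauchy_seriesP cau.
apply/cauchy_cvgP/cauchy_seriesP => e /cau.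
apply: filterS => n /=; rewrite ger0_norm ?sumr_ge0//.
by apply: le_lt_trans; apply: ler_norm_sum.
Qed.

Lemma is_cvg_series_exp (q : K) : 0 <= q < 1 -> cvgn (series (fun n => q ^+ n)).
Proof.
move=> /andP[q0 q1]; apply: (@is_cvg_nneg_series _ _ (1 - q)^-1) => n.
  exact: exprn_ge0.
rewrite -[leRHS]mul1r ler_pdivlMr ?subr_gt0// /series /= big_mkord mulrC.
by rewrite -opprB mulNr -subrX1 opprB gerBl exprn_ge0.
Qed.

(** The solution is the sum of the iterates [R^n y], dominated by a geometric series; [x - R x]
    telescopes to the limit of [y - R^n y], which is [y]. *)
Lemma neumann_series (R : H -> H) (q : K) : linear R -> 0 <= q < 1 ->
  (forall x, `|R x| <= q * `|x|) -> forall y, exists x, x - R x = y.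
Proof.
move=> lR q01 Rq y; pose u n := iter n R y.
have u_le n : `|u n| <= q ^+ n * `|y|.
  elim: n => [|n IHn]; first by rewrite expr0 mul1r.
  rewrite exprS -mulrA; apply: le_trans (Rq _) _.
  by rewrite ler_wpM2l//; case/andP: q01.
have cu : cvgn (series u).
  apply: is_cvg_hilbert_normed_series.
  apply: (@nneg_series_le_cvg _ _ (`|y| *: (fun n => q ^+ n))) => [n|].
    by rewrite normr_ge0 /= !fctE /= [_ *: _]mulrC.
  by apply: is_cvg_seriesZ; exact: is_cvg_series_exp.
have bR : bounded_op R by split=> //; exists q.
exists (limn (series u)).
apply: (@cvg_unique _ (@norm_hausdorff _ _)) (cvgB cu (bounded_op_cvg bR cu)) _.
have -> : series u - (R \o series u) = (fun n => y - u n).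
  apply/funext => n; rewrite !fctE /= (linear_op_sum lR) /series /=.
  rewrite -sumrB (eq_bigr (fun i => - (u i.+1 - u i))) => [|i _]; last first.
    by rewrite opprB.
  by rewrite sumrN telescope_sumr// opprB.
have := cvgB (cvg_cst y) (cvg_series_cvg_0 cu); rewrite subr0; exact.
Qed.

(** Coercivity and Cauchy-Schwarz give [m * |x| <= |S x|], hence injectivity and the bound [m^-1] on
    the inverse. Surjectivity holds because [1 - t S] is a contraction for a suitable [t]. *)
Lemma invertible_op_coercive (S : H -> H) (m : K) : bounded_op S -> 0 < m ->
  (forall x, m * `|x| ^+ 2 <= inner (S x) x) -> invertible_op S.
Proof.
move=> bS m0 Sm; have lS := bS.1.
have S_ge x : m * `|x| <= `|S x|.
  have [->|x0] := eqVneq x 0; first by rewrite normr0 mulr0.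
  rewrite -(ler_pM2r (_ : 0 < `|x|)) ?normr_gt0// -mulrA -expr2.
  apply: le_trans (Sm x) _; apply: le_trans (normr_inner_le _ _).
  by rewrite ger0_norm//; apply: le_trans (Sm x); rewrite mulr_ge0 ?exprn_ge0// ltW.
have S_inj : injective S.
  move=> x y xy; apply/eqP; rewrite -subr_eq0 -normr_le0 -(pmulr_rle0 _ m0).
  by rewrite (le_trans (S_ge _))// (linear_opB lS) xy subrr normr0.
have [M M0 SM] := bounded_op_gt0 bS.
(* Enlarging the bound by [m] forces [m / N < 1], hence [0 <= r < 1]. *)
pose N := M + m; have N0 : 0 < N by rewrite addr_gt0.
have SN x : `|S x| <= N * `|x|.
  by apply: le_trans (SM x) _; rewrite ler_wpM2r// lerDl ltW.
(* This [t] minimizes [1 - 2 t m + t^2 N^2], the bound on the squared contraction factor; the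
   minimum is [r]. *)
pose t := m / N ^+ 2; have t0 : 0 < t by rewrite divr_gt0 ?exprn_gt0.
pose r := 1 - (m / N) ^+ 2.
have mN : 0 < m / N < 1 by rewrite divr_gt0//= ltr_pdivrMr// mul1r ltrDr.
have /andP[mN0 mN1] := mN.
have r0 : 0 <= r by rewrite subr_ge0 exprn_ile1// ltW.
have q01 : 0 <= scalar_sqrt r < 1.
  rewrite scalar_sqrt_ge0 /= -(@ltr_pXn2r _ 2)// ?nnegrE ?scalar_sqrt_ge0//.
  by rewrite sqr_scalar_sqrt// expr1n ltrBlDr ltrDl exprn_gt0.
have [B SB] : {B : H -> H & cancel B S}.
  apply: (@choice _ _ (fun y x => S x = y)) => y.
  pose R x := x - t *: S x.
  have lR : linear R.
    move=> a x z; rewrite /R lS scalerDr opprD !scalerA [t * a]mulrC -scalerA.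
    by rewrite addrACA scalerBr.
  (* Solving [x - R x = t y] amounts to [t S x = t y]. *)
  have [|x] := neumann_series R _ lR q01 _ (t *: y); last first.
    by rewrite /R subKr => /(scalerI (lt0r_neq0 t0)); exists x.
  move=> x; rewrite -(@ler_pXn2r _ 2)// ?nnegrE ?mulr_ge0 ?scalar_sqrt_ge0//.
  rewrite exprMn sqr_scalar_sqrt// normr_inner /R.
  have Sx0 : 0 <= inner (S x) x.
    by apply: le_trans (Sm x); rewrite mulr_ge0 ?exprn_ge0// ltW.
  rewrite linearBl !linearBr !linearZl_LR !linearZr_LR /=.
  (* Being nonnegative, [inner (S x) x] is fixed by conjugation, so the two cross terms agree. *)
  rewrite [inner x (S x)]inner_conj
    !(scalar_conj_ge0 Sx0, scalar_conj_ge0 (ltW t0)).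
  rewrite -!normr_inner.
  rewrite /r; refine (coercive_step_le m0 N0 (Sm x) _ (erefl t)).
  by rewrite -exprMn lerXn2r ?nnegrE ?mulr_ge0// ltW.
split=> //; exists B; split=> //; last first.
  by move=> x; apply: S_inj; rewrite SB.
split=> [a x y|]; first by apply: S_inj; rewrite lS !SB.
by exists m^-1 => x; rewrite ler_pdivlMl// -{2}[x]SB.
Qed.

End positive_operators.

Lemma weighted_AGM {F : numFieldType} (M a b : F) : 0 < M ->
  a \is Num.real -> b \is Num.real -> 2 * (a * b) <= M * a ^+ 2 + b ^+ 2 / M.
Proof.
move=> M0 aR bR; rewrite -subr_ge0.
have -> : M * a ^+ 2 + b ^+ 2 / M - 2 * (a * b) = (M * a - b) ^+ 2 / M.
  by field; rewrite gt_eqF.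
apply: divr_ge0; last exact: ltW.
by rewrite real_exprn_even_ge0// rpredB ?rpredM// gtr0_real.
Qed.

(** The upper half of the frame inequality, which makes analysis and synthesis bounded. *)
Definition bessel {K : scalarField} {H : hilbertType K} (Phi : nat -> H)
    (M : K) : Prop :=
  forall f, let energy : nat -> K := series (fun n => `|inner f (Phi n)| ^+ 2) in
  cvgn energy /\ limn energy <= M * `|f| ^+ 2.

(** * Analysis, synthesis and frame operators of a Bessel sequence *)

Section bessel_sequences.
Context {K : scalarField} {H : hilbertType K} {Phi : nat -> H} {M : K}.
Hypotheses (M_gt0 : 0 < M) (besselPhi : bessel Phi M).

Lemma analysis_opE f n : analysis_op Phi f n = inner f (Phi n).
Proof.
rewrite -[LHS]/(val (analysis_op Phi f) n) /analysis_op insubdK//.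
by apply/square_summableP; case: (besselPhi f).
Qed.

Lemma normr_analysis_op f :
  `|analysis_op Phi f| ^+ 2 = limn (series (fun n => `|inner f (Phi n)| ^+ 2 : K)).
Proof.
apply/esym/cvg_lim; first exact: norm_hausdorff.
by under eq_fun do rewrite -analysis_opE; exact: cvg_ell2_norm.
Qed.

Lemma normr_analysis_op_le f : `|analysis_op Phi f| <= scalar_sqrt M * `|f|.
Proof.
rewrite -(@ler_pXn2r _ 2)// ?nnegrE ?mulr_ge0 ?scalar_sqrt_ge0//.
rewrite exprMn (sqr_scalar_sqrt (ltW M_gt0)) normr_analysis_op.
by case: (besselPhi f).
Qed.

Lemma bounded_analysis_op : bounded_op (analysis_op Phi).
Proof.
split; last by exists (scalar_sqrt M) => f; exact: normr_analysis_op_le.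
move=> a f g; apply/val_inj/funext => n /=.
by rewrite !fctE !analysis_opE linearPl.
Qed.

Lemma bessel_sum_le f m n :
  \sum_(m <= k < n) `|inner f (Phi k)| ^+ 2 <= M * `|f| ^+ 2.
Proof.
have [cf] := besselPhi f; apply: le_trans.
apply: le_trans (nneg_series_le n cf _); last by move=> k; exact: exprn_ge0.
have [nm|mn] := leqP n m.
  by rewrite big_geq// /series /= sumr_ge0// => k _; exact: exprn_ge0.
rewrite -subr_ge0 /series /= (@big_cat_nat _ _ _ m 0 n)//=; last exact: ltnW.
by rewrite addrK sumr_ge0// => k _; exact: exprn_ge0.
Qed.

(** Expand [|g|^2] as the sum of [c k * inner (Phi k) g]. The weighted AM-GM inequality bounds
    [2 |g|^2] by [M] times the sum of the [|c k|^2], plus the energy of [g] over [M]; the latter is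
    at most [|g|^2] and is absorbed on the left. *)
Lemma normr_synthesis_sum_le (c : nat -> K) m n :
  `|\sum_(m <= k < n) c k *: Phi k| ^+ 2 <= M * \sum_(m <= k < n) `|c k| ^+ 2.
Proof.
set g := \sum_(m <= k < n) _.
have gg : `|g| ^+ 2 = \sum_(m <= k < n) c k * inner (Phi k) g.
  rewrite normr_inner {1}/g linear_sumlz.
  by apply: eq_bigr => k _; rewrite linearZl_LR.
have amgm k : 2 * `|c k * inner (Phi k) g| <=
    M * `|c k| ^+ 2 + `|inner g (Phi k)| ^+ 2 / M.
  rewrite inner_conj normrM normr_scalar_conj.
  by apply: weighted_AGM; rewrite ?normr_real.
have : 2 * `|g| ^+ 2 <= M * \sum_(m <= k < n) `|c k| ^+ 2 + `|g| ^+ 2.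
  rewrite -{1}[_ ^+ 2]ger0_norm ?exprn_ge0// {1}gg.
  apply: (@le_trans _ _ (2 * \sum_(m <= k < n) `|c k * inner (Phi k) g|)).
    by rewrite ler_pM2l// ler_norm_sum.
  rewrite mulr_sumr; apply: le_trans (ler_sum _ (fun k _ => amgm k)) _.
  rewrite big_split /= -mulr_sumr lerD2l -mulr_suml ler_pdivrMr//.
  rewrite [leRHS]mulrC; exact: bessel_sum_le.
by rewrite mulr2n mulrDl !mul1r lerD2r.
Qed.

Lemma is_cvg_synthesis (c : ell2 K) : cvgn (series (fun n => c n *: Phi n)).
Proof.
apply/cauchy_cvgP/cauchy_seriesP => e e0.
have /square_summableP/cvg_cauchy/cauchy_seriesP := ell2P c.
(* A block of [|c k|^2] below [e^2 / M] makes the synthesized block shorter than [e]. *)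
move=> /(_ (e ^+ 2 / M)); rewrite divr_gt0 ?exprn_gt0// => /(_ isT).
apply: filterS => n /=; rewrite ger0_norm => [nM|]; last first.
  by rewrite sumr_ge0// => k _; exact: exprn_ge0.
rewrite -(@ltr_pXn2r _ 2)// ?nnegrE ?(ltW e0)//.
apply: le_lt_trans (normr_synthesis_sum_le _ _ _) _.
by rewrite mulrC -ltr_pdivlMr.
Qed.

(** Synthesis and analysis are adjoint to each other; linearity and boundedness of synthesis are
    then obtained by testing against vectors. *)
Lemma inner_synthesis_op c f :
  inner (synthesis_op Phi c) f = inner c (analysis_op Phi f).
Proof.
apply: (@cvg_unique _ (@norm_hausdorff _ _))
  (cvg_inner _ _ f (is_cvg_synthesis c)) _.
rewrite (_ : (fun _ => _) =
    series (fun n => c n * scalar_conj (analysis_op Phi f n))).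
  exact: cvg_ell2_inner.
apply/funext => n; rewrite /series /= linear_sumlz; apply: eq_bigr => k _.
by rewrite linearZl_LR /= analysis_opE -inner_conj.
Qed.

Lemma linear_synthesis_op : linear (synthesis_op Phi).
Proof.
move=> a c d; apply: inner_injl => f.
rewrite inner_synthesis_op linearPl [RHS]linearPl.
by congr (_ * _ + _); rewrite -[LHS]inner_synthesis_op.
Qed.

Lemma bounded_synthesis_op : bounded_op (synthesis_op Phi).
Proof.
split; first exact: linear_synthesis_op.
exists (scalar_sqrt M) => c; set g := synthesis_op Phi c.
have [->|g0] := eqVneq g 0; first by rewrite normr0 mulr_ge0 ?scalar_sqrt_ge0.
rewrite -(ler_pM2r (_ : 0 < `|g|)) ?normr_gt0// -expr2 normr_inner.
rewrite inner_synthesis_op -[leLHS]ger0_norm; last first.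
  by rewrite -inner_synthesis_op -normr_inner exprn_ge0.
apply: le_trans (normr_inner_le _ _) _.
by rewrite mulrAC [leRHS]mulrC ler_wpM2l// normr_analysis_op_le.
Qed.

Lemma bounded_frame_op : bounded_op (frame_op Phi).
Proof. exact: bounded_op_comp bounded_synthesis_op bounded_analysis_op. Qed.

Lemma inner_frame_op f g : inner (frame_op Phi f) g = inner f (frame_op Phi g).
Proof.
by rewrite inner_synthesis_op [RHS]inner_conj inner_synthesis_op -inner_conj.
Qed.

End bessel_sequences.

(** * Frames: inverse frame operator and adjoints *)

Section frame_theory.
Context {K : scalarField} {H : hilbertType K} {Phi : nat -> H}.

Lemma frame_bessel : frame Phi -> exists2 M, 0 < M & bessel Phi M.
Proof.
move=> [m [M [m0 M0 mM]]]; exists M => // f.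
by have [? /andP[]] := mM f.
Qed.

(** The energy of [f] is [|V f|^2], so [c^-2] and the square of a bound of [V] are frame bounds. A
    given [V] replaces [analysis_op], which defaults to 0 while square summability is unknown. *)
Lemma frame_of_analysis (V : H -> ell2 K) (c : K) : bounded_op V -> 0 < c ->
  (forall f, `|f| <= c * `|V f|) -> (forall f n, V f n = inner f (Phi n)) ->
  frame Phi.
Proof.
move=> bV c0 V_ge VE; have [N N0 VN] := bounded_op_gt0 bV.
have energyV f : series (fun n => `|inner f (Phi n)| ^+ 2) @ \oo --> `|V f| ^+ 2.
  by under eq_fun do rewrite -VE; exact: cvg_ell2_norm.
exists (c ^- 2), (N ^+ 2); split; rewrite ?invr_gt0 ?exprn_gt0// => f energy.
split; first by apply/cvg_ex; exists (`|V f| ^+ 2); exact: energyV.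
rewrite (cvg_lim (@norm_hausdorff _ _) (energyV f)).
rewrite ler_pdivrMl ?exprn_gt0// -!exprMn !lerXn2r ?nnegrE ?mulr_ge0//; exact: ltW.
Qed.

Hypothesis framePhi : frame Phi.

(** The form [<S f, f>] is the energy of [f], so the lower frame bound is a coercivity constant. *)
Lemma invertible_frame_op : invertible_op (frame_op Phi).
Proof.
have [M M0 bPhi] := frame_bessel framePhi; have [m [M' [m0 _ mM]]] := framePhi.
apply: (@invertible_op_coercive _ _ _ m) => //; first exact: bounded_frame_op bPhi.
move=> f; rewrite (inner_synthesis_op M0 bPhi) -normr_inner.
by rewrite (normr_analysis_op bPhi); case: (mM f) => _ /andP[].
Qed.

(* Riesz representation of [x |-> <T x, y>] through the frame: with
   [d_n = <y, T phi_n>], which is square summable, [<T (S x), y> = <x, T_Phi d>]. *)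
Lemma inner_adjoint {W : preHilbertType K} (T : H -> W) (x : H) (y : W) :
  bounded_op T -> inner (T x) y = inner x (adjoint T y).
Proof.
move=> bT; suff [z zP] : exists z, forall x, inner (T x) y = inner x z.
  by rewrite (adjoint_unique T y z).
have [M M0 bPhi] := frame_bessel framePhi.
have [_ [B [bB SB BS]]] := invertible_frame_op.
have [C C0 TC] := bounded_op_gt0 bT.
have TsumE (c : nat -> K) n :
    inner (T (series (fun k => c k *: Phi k) n)) y =
    series (fun k => c k * inner (T (Phi k)) y) n.
  rewrite (linear_op_sum bT.1) /series /= linear_sumlz.
  by apply: eq_bigr => k _; rewrite (linear_opZ bT.1) linearZl_LR.
have dP : (fun n => inner y (T (Phi n))) \in @square_summable K.
  apply/square_summableP.
  apply: (@is_cvg_nneg_series _ _ ((C * `|y|) ^+ 2 * M)) => n.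
    exact: exprn_ge0.
  (* Let [g] be the partial synthesis of the [d_k]. Then [s = <T g, y> <= C |y| |g|] and
     [|g|^2 <= M s], so [s^2 <= (C |y|)^2 M s]; cancelling [s] bounds the partial sums. *)
  set s := series _ n.
  have sE : s = inner (T (series (fun k => inner y (T (Phi k)) *: Phi k) n)) y.
    rewrite TsumE /s /series /=; apply: eq_bigr => k _.
    by rewrite -mul_scalar_conj -inner_conj.
  have s0 : 0 <= s by rewrite /s /series /= sumr_ge0// => k _; exact: exprn_ge0.
  have [->|sN0] := eqVneq s 0.
    by rewrite mulr_ge0 ?(ltW M0)// exprn_ge0// mulr_ge0// ltW.
  rewrite -(@ler_pM2r _ s) ?lt0r ?sN0// -expr2.
  apply: (@le_trans _ _ ((C * `|y|) ^+ 2 *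
      `|series (fun k => inner y (T (Phi k)) *: Phi k) n| ^+ 2)).
    rewrite -exprMn lerXn2r ?nnegrE ?mulr_ge0 ?(ltW C0)//.
    rewrite -[leLHS]ger0_norm// sE; apply: le_trans (normr_inner_le _ _) _.
    by rewrite mulrAC ler_wpM2r.
  rewrite -[leRHS]mulrA; apply: ler_wpM2l.
    by rewrite exprn_ge0// mulr_ge0// ltW.
  exact: normr_synthesis_sum_le.
pose d := Ell2 dP.
have TsynthE c : inner (T (synthesis_op Phi c)) y = inner c d.
  apply: (@cvg_unique _ (@norm_hausdorff _ _))
    (cvg_inner _ _ y (bounded_op_cvg bT (is_cvg_synthesis M0 bPhi c))) _.
  rewrite (_ : (fun _ => _) = series (fun n => c n * scalar_conj (d n))).
    exact: cvg_ell2_inner.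
  apply/funext => n; rewrite [LHS]TsumE.
  by apply: eq_bigr => k _; rewrite -inner_conj.
(* Write [u] as the synthesis of the analysis of [B u]; self-adjointness of the frame operator then
   moves [B] onto the synthesis of [d]. *)
exists (B (synthesis_op Phi d)) => u; rewrite -{1}[u]BS TsynthE.
rewrite inner_conj -(inner_synthesis_op M0 bPhi) -inner_conj.
by rewrite -{1}[synthesis_op Phi d]BS -(inner_frame_op M0 bPhi) BS.
Qed.

(** The inverse frame operator is self-adjoint, so it moves from [Phi n] to [f]. *)
Lemma inner_canonical_dual f n :
  inner f (canonical_dual Phi n) = analysis_op Phi (op_inv (frame_op Phi) f) n.
Proof.
have [M M0 bPhi] := frame_bessel framePhi.
have [_ [B [_ SB BS]]] := invertible_frame_op.
rewrite (analysis_opE bPhi) /canonical_dual (op_invE SB BS).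
by rewrite -{1}[f]BS (inner_frame_op M0 bPhi) BS.
Qed.

End frame_theory.

Theorem theorem2p9 (K : scalarField) (H : hilbertType K) (sepH : separable H)
    (Phi : nat -> H) (frame_Phi : frame Phi)
    (A : H -> H) (inv_A : invertible_op A) (Phi_gd : nat -> H) :
  g_dual_frame Phi A Phi_gd <->
  exists2 Theta : H -> ell2 K, op_ran (synthesis_op Phi) Theta &
    forall n, Phi_gd n = adjoint (op_inv A) (canonical_dual Phi n)
                         + adjoint Theta (ell2_basis K n).
Proof.
have [M M0 bPhi] := frame_bessel frame_Phi.
have [_ [B [bB SB BS]]] := invertible_frame_op frame_Phi.
have [bA [A' [bA' AA' A'A]]] := inv_A.
have bT := bounded_synthesis_op M0 bPhi.
pose W := analysis_op Phi \o (B \o A').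
have bW : bounded_op W.
  exact: bounded_op_comp (bounded_analysis_op M0 bPhi) (bounded_op_comp bB bA').
have TW f : synthesis_op Phi (W f) = A' f by exact: BS.
have innerW f n : inner f (adjoint (op_inv A) (canonical_dual Phi n)) = W f n.
  rewrite (op_invE AA' A'A) -(inner_adjoint frame_Phi)//.
  by rewrite (inner_canonical_dual frame_Phi) (op_invE SB BS).
split=> [[frame_gd gdE]|[Theta [bTheta TTheta] gdE]].
  have [N N0 bgd] := frame_bessel frame_gd.
  have Tgd f : synthesis_op Phi (analysis_op Phi_gd f) = A' f.
    apply: cvg_lim; first exact: norm_hausdorff.
    (* Reconstructing [A' f] expands it with the coefficients of [f] itself. *)
    have := gdE (A' f); rewrite A'A.
    by under eq_fun do rewrite -(analysis_opE bgd).
  exists (analysis_op Phi_gd \- W).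
    split; first exact: bounded_opB (bounded_analysis_op N0 bgd) bW.
    by move=> f; rewrite (linear_opB bT.1) Tgd TW subrr.
  (* The [n]-th coordinate of the difference applied to [f] is the inner product of [f] with this
     vector. *)
  move=> n; rewrite (adjoint_unique (analysis_op Phi_gd \- W) _
    (Phi_gd n - adjoint (op_inv A) (canonical_dual Phi n))) ?subrKC// => f.
  by rewrite inner_ell2_basis linearBr /= innerW -(analysis_opE bgd).
(* [V] has the coefficients against [Phi_gd] as coordinates, and this proves them square summable
   before [Phi_gd] is known to be a frame. *)
pose V := W \+ Theta.
have bV : bounded_op V by exact: bounded_opD.
have VE f n : V f n = inner f (Phi_gd n).
  by rewrite gdE linearDr /= innerW -(inner_adjoint frame_Phi)// inner_ell2_basis.
have TV f : synthesis_op Phi (V f) = A' f.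
  rewrite (_ : V f = 1 *: W f + Theta f); last by rewrite scale1r.
  by rewrite bT.1 TTheta addr0 scale1r TW.
split=> [|f].
  (* Here [c] bounds [A] after synthesis, a left inverse of [V]. *)
  have [c c0 Tc] := bounded_op_gt0 (bounded_op_comp bA bT).
  apply: (frame_of_analysis V c) => // f.
  by rewrite -{1}[f]A'A -TV; exact: Tc.
rewrite -{2}[f]AA' -TV.
by under eq_fun do rewrite -VE; exact: is_cvg_synthesis M0 bPhi _.
Qed.
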